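(* Let $K$ be a compact line and $G: K \to \mathbb{R}$ be a fixed function. If $f_1, f_2: K \to \mathbb{R}$ are $G$-integrable, and $\lambda$ is a real scalar, then $\lambda f_1 + f_2$ is $G$-integrable, and \[\int_K (\lambda f_1 + f_2) \, dG = \lambda \int_K f_1 \, dG + \int_K f_2 \, dG.\] Furthermore, if a function $f: K \to \mathbb{R}$ is integrable with respect to functions $G_1,G_2:K\to\mathbb R$, then for every real scalar $\lambda$, $f$ is integrable with respect to $\lambda G_1 + G_2$, and \[\int_K f \, d(\lambda G_1 + G_2) = \lambda \int_K f \, dG_1 + \int_K f \, dG_2.\]
   Context: A compact line is a nonempty linearly ordered set $K$ whose order topology is compact; $0_K$ and $1_K$ denote its least and greatest elements (they exist), and intervals are written as usual, e.g. $(x,y]=\{z\in K: x<z\le y\}$. An open interval of $K$ is an interval that is an open subset of $K$. A partition of $K$ is $P=\{([x_{i-1},x_i],t_i):1\le i\le n\}$ with $0_K=x_0\le x_1\le\dots\le x_n=1_K$ in $K$ and $t_i\in[x_{i-1},x_i]$. A gauge on $K$ is a function $\delta$ assigning to each $x\in K$ an open interval $\delta(x)$ of $K$ with $x\in\delta(x)$. $P$ is $\delta$-fine, written $P\ll\delta$, if $(x_{i-1},x_i]\subset\delta(t_i)$ for all $i$. For $f,G:K\to\mathbb R$ set $S(f,G,P)=f(0_K)G(0_K)+\sum_{i=1}^n f(t_i)(G(x_i)-G(x_{i-1}))$. The function $f$ is $G$-integrable (integrable with respect to $G$), with integral $\int_K f\,dG=A\in\mathbb R$, if for each $\varepsilon>0$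 there is a gauge $\delta$ on $K$ such that $|S(f,G,P)-A|<\varepsilon$ for every $P\ll\delta$. *)

(* Defs.v *)
From HB Require Import structures.
From mathcomp Require Import all_boot all_order all_algebra.
From mathcomp Require Import all_classical reals topology.

Set Implicit Arguments.
Unset Strict Implicit.
Unset Printing Implicit Defensive.

Import Order.TTheory GRing.Theory Num.Theory.
Local Open Scope classical_set_scope.
Local Open Scope ring_scope.

HB.mixin Record OrderTopological_isCompactLine d K of OrderTopological d K := {
  line_nonempty : [set: K] !=set0 ;
  line_compact : compact [set: K]
}.

#[short(type="compactLineType")]
HB.structure Definition CompactLine d :=
  { K of OrderTopological d K & OrderTopological_isCompactLine d K }.

Section CompactLineEnds.
Context {d : Order.disp_t} (K : compactLineType d).

Let chain_not_cover (U : K -> set K) :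
    (forall x, open (U x)) -> (forall x, ~ U x x) ->
    (forall x y, U x `<=` U y \/ U y `<=` U x) ->
  exists m, forall x, ~ U x m.
Proof.
move=> Uopen Uirr Utot; have [x0 _] := @line_nonempty d K.
pose F := filter_from [set: K] (fun x => ~` U x).
have FF : ProperFilter F.
  apply: filter_from_proper; last by move=> x _; exists x; exact: Uirr.
  apply: filter_from_filter; first by exists x0.
  move=> x y _ _; have [xy|yx] := Utot x y; [exists y|exists x] => // z nz.
    by split => // /xy.
  by split => // /yx.
have [m [_ mF]] := @line_compact d K F FF filterT.
exists m => x Uxm; have [] // := mF (~` U x) (U x).
- by exists x.
- exact: open_nbhs_nbhs.
- by move=> z [].
Qed.

Lemma exists_line0 : exists m : K, forall x, (m <= x)%O.
Proof.
have [|||m mP] := @chain_not_cover (fun x : K => `]x, +oo[%classic).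
- exact: rray_open.
- by move=> x /=; rewrite in_itv /= ltxx.
- move=> x y; case: (leP x y) => [xy|/ltW yx]; [right|left] => z /=;
    rewrite !in_itv /= !andbT; exact: le_lt_trans.
by exists m => x; have := mP x; rewrite /= in_itv /= andbT => /negP; rewrite -leNgt.
Qed.

Lemma exists_line1 : exists m : K, forall x, (x <= m)%O.
Proof.
have [|||m mP] := @chain_not_cover (fun x : K => `]-oo, x[%classic).
- exact: lray_open.
- by move=> x /=; rewrite in_itv /= ltxx.
- move=> x y; case: (leP x y) => [xy|/ltW yx]; [left|right] => z /=;
    rewrite !in_itv /= => zx; exact: lt_le_trans zx _.
by exists m => x; have := mP x; rewrite /= in_itv /= => /negP; rewrite -leNgt.
Qed.

Definition line0 : K := sval (cid exists_line0).
Definition line1 : K := sval (cid exists_line1).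

Lemma line0_le (x : K) : (line0 <= x)%O.
Proof. by rewrite /line0; case: cid. Qed.

Lemma le_line1 (x : K) : (x <= line1)%O.
Proof. by rewrite /line1; case: cid. Qed.

(* Only the points part_pt 0, ..., part_pt part_size and the tags part_tag 0,
   ..., part_tag (part_size - 1) are meaningful; part_tag i, the tag of the
   interval from part_pt i to part_pt i.+1, is written t_(i+1) on paper. *)
Record partition := Partition {
  part_size : nat ;
  part_pt : nat -> K ;
  part_tag : nat -> K ;
  part_pt0 : part_pt 0%N = line0 ;
  part_pt_last : part_pt part_size = line1 ;
  part_le : forall i, (i < part_size)%N -> (part_pt i <= part_pt i.+1)%O ;
  part_tagP : forall i, (i < part_size)%N ->
    part_tag i \in `[part_pt i, part_pt i.+1]
}.

(* In a compact line every convex set has a supremum and an infimum, so that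
   [interval K] captures all intervals. Openness is that of the subset: e.g.
   `[line0, x[ is allowed. *)
Definition gauge (delta : K -> interval K) : Prop :=
  forall x, open [set` delta x] /\ x \in delta x.

Definition fine (delta : K -> interval K) (P : partition) : Prop :=
  forall i, (i < part_size P)%N ->
    `]part_pt P i, part_pt P i.+1] `<=` [set` delta (part_tag P i)].

Section Integral.
Context {R : realType}.
Implicit Types f G : K -> R.

Definition riemann_sum f G (P : partition) : R :=
  f line0 * G line0 +
  \sum_(i < part_size P)
    f (part_tag P i) * (G (part_pt P i.+1) - G (part_pt P i)).

Definition has_integral f G (A : R) : Prop :=
  forall e : R, 0 < e -> exists delta : K -> interval K, gauge delta /\
    forall P, fine delta P -> `|riemann_sum f G P - A| < e.

Definition line_integrable f G : Prop := exists A : R, has_integral f G A.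

(* The value A is unique, since every gauge admits a fine partition; the default
   0 is only returned for a function that is not integrable. *)
Definition line_integral f G : R := xget 0 [set A | has_integral f G A].

End Integral.
End CompactLineEnds.

(* Main.v *)
(* Linearity at the level of [has_integral] is immediate: the Riemann sums are
   bilinear in the pair of functions, and a partition fine for the intersection
   of two gauges is fine for both. Passing to the values [line_integral] needs
   uniqueness of the integral, hence Cousin's lemma: every gauge [delta] admits
   a fine partition. For the latter, let S be the set of the x up to which a
   fine chain from 0_K exists. By compactness S has a supremum m, which lies in
   S because [delta m] reaches down to a point of S. If m < 1_K, then the chain
   can be continued past m: either [delta m] contains some z > m, or m has an
   immediate successor z, and then (m, z] = {z} is covered by the tag z. *)
Require Import Defs.
From HB Require Import structures.
From mathcomp Require Import all_boot all_order all_algebra.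
From mathcomp Require Import all_classical reals topology.

Set Implicit Arguments.
Unset Strict Implicit.
Unset Printing Implicit Defensive.

Import Order.TTheory GRing.Theory Num.Theory.
Local Open Scope classical_set_scope.
Local Open Scope ring_scope.

Section Cousin.
Context {d : Order.disp_t} {K : compactLineType d}.
Implicit Types (delta : K -> interval K) (P : Defs.partition K).

Lemma mem_itv_between (i : interval K) (x y z : K) :
  x \in i -> z \in i -> (x <= y <= z)%O -> y \in i.
Proof.
case: i => a b xi zi /andP[xy yz]; move: xi zi; rewrite !itv_boundlr.
move=> /andP[ax _] /andP[_ zb]; apply/andP; split.
  by apply: le_trans ax _; rewrite bnd_simp.
by apply: le_trans _ zb; rewrite bnd_simp.
Qed.

(** Compactness replaces order completeness: [m] is a cluster point of the filter generated by the
    tails of [S]. A point [s] of [S] above [m] is impossible, since the ray below [s] is a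
    neighbourhood of [m] that misses the tail from [s]. *)
Lemma line_adherent_sup (S : set K) : S !=set0 ->
  exists m : K, (forall s, S s -> (s <= m)%O) /\
    (forall U, nbhs m U -> exists2 s, S s & U s).
Proof.
move=> [s0 Ss0].
pose F := filter_from S (fun s => [set x | S x /\ (s <= x)%O]).
have FF : ProperFilter F.
  apply: filter_from_proper; last by move=> s Ss; exists s; split.
  apply: filter_from_filter; first by exists s0.
  move=> s t Ss St; have [st|ts] := leP s t.
    by exists t => // x [Sx tx]; split; split=> //; exact: le_trans tx.
  exists s => // x [Sx sx]; split; split=> //.
  by apply: le_trans (ltW ts) sx.
have [m [_ mF]] := @line_compact d K F FF filterT.
exists m; split=> [s Ss|U mU]; last first.
  have FS : F S by exists s0 => // x [].
  by have [x [Sx Ux]] := mF _ _ FS mU; exists x.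
rewrite leNgt; apply/negP => ms.
have Fs : F [set x | S x /\ (s <= x)%O] by exists s.
have ms_nbhs : nbhs m `]-oo, s[%classic.
  by apply: open_nbhs_nbhs; split; [exact: lray_open|rewrite /= in_itv].
have [x [[_ sx]]] := mF _ _ Fs ms_nbhs.
by rewrite /= in_itv /= ltNge sx.
Qed.

Lemma nbhs_right_or_succ (m : K) (U : set K) : nbhs m U -> (m < line1 K)%O ->
  exists2 z, (m < z)%O & U z \/ (forall y, (m < y)%O -> (z <= y)%O).
Proof.
rewrite itv_nbhsE => -[[a [[] b|[]]] [/= io mi] iU] m1.
- have mb : (m < b)%O by move: mi; rewrite itv_boundlr bnd_simp => /andP[].
  have [[z /andP[mz zb]]|nz] := pselect (exists z, (m < z < b)%O).
    exists z => //; left; apply: iU => /=; move: mi; rewrite !itv_boundlr.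
    move=> /andP[am _]; rewrite bnd_simp zb andbT.
    by apply: le_trans am _; rewrite bnd_simp ltW.
  exists b => //; right=> y my; rewrite leNgt; apply/negP => yb.
  by apply: nz; exists y; rewrite my.
(* A closed right end is excluded by [io], and the right end [-oo] by [mi]. *)
- by case: a io {mi iU} => [[]|[]].
- by move: mi; rewrite itv_boundlr /= andbC.
- exists (line1 K) => //; left; apply: iU => /=; move: mi; rewrite !itv_boundlr.
  move=> /andP[am _]; rewrite andbC /=.
  by apply: le_trans am _; rewrite bnd_simp ltW.
Qed.

Definition fine_step delta (x t y : K) : Prop :=
  t \in `[x, y] /\ `]x, y] `<=` [set` delta t].

Definition fine_chain delta (n : nat) (p t : nat -> K) (x : K) : Prop :=
  [/\ p 0%N = line0 K, p n = x &
    forall i, (i < n)%N -> fine_step delta (p i) (t i) (p i.+1)].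

Definition fine_reach delta (x : K) : Prop := exists n p t, fine_chain delta n p t x.

Lemma fine_reach0 delta : fine_reach delta (line0 K).
Proof. by exists 0%N, (fun=> line0 K), (fun=> line0 K). Qed.

Lemma fine_reach_step delta (x t y : K) :
  fine_reach delta x -> fine_step delta x t y -> fine_reach delta y.
Proof.
move=> [n [p [u [p0 pn pP]]]] xty; exists n.+1.
(* The cutoffs differ because a chain has one more point than tags: index [n] keeps the point
   [p n = x] but receives the new tag [t]. *)
exists (fun i => if (i <= n)%N then p i else y).
exists (fun i => if (i < n)%N then u i else t).
split=> //= [|i]; first by rewrite ltnn.
rewrite ltnS => le_in; rewrite le_in; case: ltnP => [/pP //|ni].
by have -> : i = n by [apply/eqP; rewrite eqn_leq le_in]; rewrite pn.
Qed.

Lemma cousin delta : gauge delta -> exists P, fine delta P.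
Proof.
move=> gd; suff [n [p [t [p0 pn pP]]]] : fine_reach delta (line1 K).
  have pt i : (i < n)%N -> t i \in `[p i, p i.+1] by move=> /pP[].
  have ple i : (i < n)%N -> (p i <= p i.+1)%O.
    by move=> /pt; rewrite in_itv /= => /andP[]; exact: le_trans.
  by exists (Partition p0 pn ple pt) => i /pP[].
have [|m [ubm adhm]] := @line_adherent_sup (fine_reach delta).
  by exists (line0 K); exact: fine_reach0.
have dm : nbhs m [set` delta m].
  by have [od md] := gd m; exact: open_nbhs_nbhs.
have rm : fine_reach delta m.
  have [s rs ds] := adhm _ dm.
  apply: (fine_reach_step (t := m) rs); split=> [|z /=].
    by rewrite in_itv /= lexx ubm.
  rewrite in_itv /= => /andP[sz zm].
  by apply: (mem_itv_between ds (gd m).2); rewrite zm ltW.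
have := le_line1 m; rewrite le_eqVlt => /predU1P[<- //|m1].
have [z mz zP] := nbhs_right_or_succ dm m1.
(* Reaching [z] contradicts the maximality of [m], so the case [m < line1 K] cannot occur. *)
suff /ubm : fine_reach delta z by rewrite leNgt mz.
case: zP => [dz|succ].
  apply: (fine_reach_step (t := m) rm); split=> [|y /=].
    by rewrite in_itv /= lexx ltW.
  rewrite in_itv /= => /andP[my yz].
  by apply: (mem_itv_between (gd m).2 dz); rewrite yz ltW.
apply: (fine_reach_step (t := z) rm); split=> [|y /=].
  by rewrite in_itv /= lexx ltW.
rewrite in_itv /= => /andP[/succ zy yz].
by have -> : y = z by [apply/le_anti; rewrite yz]; exact: (gd z).2.
Qed.

(** The meet is taken in the lattice of intervals, so that the value is again an [interval K];
    [set_itvI] turns it into a set intersection. *)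
Definition gauge_meet delta1 delta2 (x : K) : interval K :=
  (delta1 x `&` delta2 x)%O.

Lemma gauge_meetP delta1 delta2 :
  gauge delta1 -> gauge delta2 -> gauge (gauge_meet delta1 delta2).
Proof.
move=> g1 g2 x; have [[o1 x1] [o2 x2]] := (g1 x, g2 x).
by split; [rewrite set_itvI; exact: openI|rewrite in_itvI x1].
Qed.

Lemma fine_meet delta1 delta2 P :
  fine (gauge_meet delta1 delta2) P -> fine delta1 P /\ fine delta2 P.
Proof.
move=> fP; split=> i iP x /(fP i iP);
  by rewrite /gauge_meet set_itvI => -[].
Qed.

End Cousin.

Section Linearity.
Context {d : Order.disp_t} {K : compactLineType d} {R : realType}.
Implicit Types (f G : K -> R) (P : Defs.partition K).

(** If [A] and [B] differed, a partition fine for both gauges would have a Riemann sum at distance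
    less than half of [|A - B|] from each of them, against the triangle inequality. *)
Lemma has_integral_unique f G (A B : R) :
  has_integral f G A -> has_integral f G B -> A = B.
Proof.
move=> hA hB; apply/eqP; rewrite -subr_eq0 -normr_le0 leNgt; apply/negP => AB0.
have e0 : 0 < `|A - B| / 2 by rewrite divr_gt0.
have [dA [gA AP]] := hA _ e0; have [dB [gB BP]] := hB _ e0.
have [P /fine_meet[/AP SA /BP SB]] := cousin (gauge_meetP gA gB).
have := ler_distD (riemann_sum f G P) A B.
by rewrite (distrC A (riemann_sum _ _ _)) leNgt [ltRHS]splitr ltrD.
Qed.

Lemma line_integralE f G (A : R) : has_integral f G A -> line_integral f G = A.
Proof. by move=> hA; apply: xget_unique => // B /has_integral_unique; apply. Qed.

Lemma line_integrableP f G :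
  line_integrable f G -> has_integral f G (line_integral f G).
Proof. by move=> [A hA]; rewrite (line_integralE hA). Qed.

(** Integrand and integrator both vary, so that one statement serves linearity in either
    argument. *)
Lemma has_integral_comb f1 G1 f2 G2 f G (l A B : R) :
  (forall P, riemann_sum f G P = l * riemann_sum f1 G1 P + riemann_sum f2 G2 P) ->
  has_integral f1 G1 A -> has_integral f2 G2 B -> has_integral f G (l * A + B).
Proof.
(* The summand 1 keeps [c] positive when [l = 0], so that division by [c] is harmless. *)
move=> SE hA hB e e0; pose c := `|l| + 1.
have c0 : 0 < c by rewrite ltr_wpDl.
have [|dA [gA AP]] := hA (e / 2 / c); first by rewrite !divr_gt0.
have [|dB [gB BP]] := hB (e / 2); first by rewrite divr_gt0.
exists (gauge_meet dA dB); split; first exact: gauge_meetP.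
move=> P /fine_meet[/AP SA /BP SB]; rewrite SE opprD addrACA -mulrBr.
(* The strict inequality comes from the second sum; the first term needs only the bound [e / 2]. *)
apply: le_lt_trans (ler_normD _ _) _; rewrite (splitr e) ler_ltD // normrM.
apply: (@le_trans _ _ (c * (e / 2 / c))).
  by apply: ler_pM => //; [rewrite lerDl|exact: ltW].
by rewrite mulrC divfK ?gt_eqF.
Qed.

Lemma line_integral_comb f1 G1 f2 G2 f G (l : R) :
  (forall P, riemann_sum f G P = l * riemann_sum f1 G1 P + riemann_sum f2 G2 P) ->
  line_integrable f1 G1 -> line_integrable f2 G2 ->
  line_integrable f G /\
  line_integral f G = l * line_integral f1 G1 + line_integral f2 G2.
Proof.
move=> SE /line_integrableP h1 /line_integrableP h2.
have h := has_integral_comb SE h1 h2.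
by split; [exists (l * line_integral f1 G1 + line_integral f2 G2)|exact: line_integralE].
Qed.

Lemma riemann_sum_combl f1 f2 G (l : R) P :
  riemann_sum (fun x => l * f1 x + f2 x) G P =
  l * riemann_sum f1 G P + riemann_sum f2 G P.
Proof.
rewrite /riemann_sum mulrDr addrACA mulr_sumr -big_split /= mulrDl mulrA.
by congr (_ + _); apply: eq_bigr => i _; rewrite mulrDl mulrA.
Qed.

Lemma riemann_sum_combr f G1 G2 (l : R) P :
  riemann_sum f (fun x => l * G1 x + G2 x) P =
  l * riemann_sum f G1 P + riemann_sum f G2 P.
Proof.
rewrite /riemann_sum !mulrDr addrACA mulr_sumr -big_split /= mulrCA.
congr (_ + _); apply: eq_bigr => i _.
(* The increment of [l * G1 + G2] is regrouped into those of [G1] and [G2]. *)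
by rewrite opprD addrACA -mulrBr mulrDr mulrCA.
Qed.

End Linearity.

Local Close Scope classical_set_scope.

Theorem proposition3p11 (R : realType) (d : Order.disp_t)
    (K : compactLineType d) :
  (forall (G f1 f2 : K -> R) (lambda : R),
     line_integrable f1 G -> line_integrable f2 G ->
     line_integrable (fun x => lambda * f1 x + f2 x) G /\
     line_integral (fun x => lambda * f1 x + f2 x) G =
       lambda * line_integral f1 G + line_integral f2 G) /\
  (forall (f G1 G2 : K -> R) (lambda : R),
     line_integrable f G1 -> line_integrable f G2 ->
     line_integrable f (fun x => lambda * G1 x + G2 x) /\
     line_integral f (fun x => lambda * G1 x + G2 x) =
       lambda * line_integral f G1 + line_integral f G2).
Proof.
split=> [G f1 f2 l|f G1 G2 l]; apply: line_integral_comb => P.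
  exact: riemann_sum_combl.
exact: riemann_sum_combr.
Qed.
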